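(* For all integers $n,j$ with $0<j\le n$, the following hold: $$c(n,j)\ \ge\ q^{6n-1}c(n-1,j-1)\,q^{2(j-1)},$$ $$c(n,j)\ \ge\ \frac{q^{6jn+5j-2j^2-4n-2}\,\bigl(1-q^{4(n-j+1)}\bigr)}{1-q^2},$$ and $$q^{(2n+1)j}\mid c(n,j),$$ where the inequalities are coefficientwise: for $\alpha,\beta\in\mathbb{R}(q)$ with expansions $\alpha=\sum a_iq^i$ and $\beta=\sum b_iq^i$, $\alpha\ge\beta$ means $a_i\ge b_i$ for all $i$.
   Context: Let $x,q$ be commuting indeterminates. A Schur partition is a partition into positive integer parts such that any two parts differ by at least $3$ and no two consecutive multiples of $3$ (i.e. $3k$ and $3k+3$) both occur as parts; the empty partition is included. For $N\ge 1$ let $D_N(m,n)$ be the number of Schur partitions $\pi$ of $n$ with all parts $\le N$ such that (number of parts of $\pi$) + (number of even parts of $\pi$) $=m$. The Alladi-Schur polynomials are $d_N(x)=\sum_{m,n\ge 0}D_N(m,n)x^mq^n$ for $N\ge 1$, with the convention $d_{-1}(x)=1$. For $n\ge 0$ let $p_n(x)=\prod_{i=1}^n(1+xq^{2i-1}+x^2q^{4i-2})$ (so $p_0(x)=1$). The $c(n,i)\in\mathbb{Z}[q]$ are defined for $n\ge 0$ by $\frac{d_{6n-1}(x)}{p_n(x)}=\sum_{i=0}^n c(n,i)x^i$ (by a theorem of Andrews the left-hand side is a polynomial in $x$ of degree at most $n$); in particular $c(0,0)=1$. Divisibility is in $\mathbb{Z}[q]$. *)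

(* Defs.v *)
From HB Require Import structures.
From mathcomp Require Import all_boot all_order all_algebra.
From mathcomp Require Import boolp classical_sets.

Set Implicit Arguments.
Unset Strict Implicit.
Unset Printing Implicit Defensive.

Import Order.TTheory GRing.Theory Num.Theory.
Local Open Scope ring_scope.

(* Z[q] is {poly int} and Z[q][x] is {poly {poly int}}: x is the outer        *)
(* indeterminate and q the inner one.                                         *)

Definition is_partition (n : nat) (s : seq nat) : bool :=
  [&& sorted geq s, all (leq 1) s & sumn s == n].

Definition schur_cond (s : seq nat) : bool :=
  pairwise (fun a b => b + 3 <= a)%N s &&
  all (fun a => (3 %| a)%N ==> ((a + 3)%N \notin s)) s.

Definition schur_weight (s : seq nat) : nat :=
  (size s + count (fun a => ~~ odd a) s)%N.

(* A partition of n has at most n parts, so the partitions of n with parts    *)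
(* at most N all occur among the sequences of length <= n over {0, ..., N}.   *)
Definition schurD (N m n : nat) : nat :=
  #|[set s : n.-bseq 'I_N.+1 |
      let p := [seq val i | i <- s] in
      [&& is_partition n p, schur_cond p & schur_weight p == m]]|.

(* The parts of a Schur partition are distinct, so schurD N m n = 0 unless    *)
(* m <= 2N and n <= N^2; see coef_alladi_schur. The negative indices carry    *)
(* the convention d_{-1} = 1.                                                 *)
Definition alladi_schur (N : int) : {poly {poly int}} :=
  match N with
  | Posz M => \poly_(m < (2 * M).+1) \poly_(n < (M * M).+1) (schurD M m n)%:Z
  | Negz _ => 1
  end.

Definition schur_p (n : nat) : {poly {poly int}} :=
  \prod_(1 <= i < n.+1)
    (1 + 'X^(2 * i - 1) *: 'X + 'X^(4 * i - 2) *: 'X^2).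

(* The quotient d_{6n-1} / p_n in Z[q][x]; it is unique (schur_quotientE),    *)
(* and the value 0 is a default for the case where p_n would not divide       *)
(* d_{6n-1}.                                                                  *)
Definition schur_quotient (n : nat) : {poly {poly int}} :=
  xget 0 [set r : {poly {poly int}} |
           alladi_schur (6 * n%:Z - 1) = schur_p n * r]%classic.

Definition schur_c (n i : nat) : {poly int} := (schur_quotient n)`_i.

Definition coef_le (a b : {poly int}) : Prop := forall i : nat, a`_i <= b`_i.

Lemma schurD_eq0 (N m n : nat) :
  (2 * N < m)%N || (N * N < n)%N -> schurD N m n = 0%N.
Proof.
move=> out; apply/eqP; rewrite cards_eq0; apply/eqP/setP => s.
rewrite !inE; apply/negP => /and3P[/and3P[_ pos /eqP sn] /andP[dif _] /eqP wm].
set p := [seq val i | i <- s] in pos sn dif wm.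
have leN a : a \in p -> (a <= N)%N.
  by case/mapP => i _ ->; rewrite -ltnS ltn_ord.
have up : uniq p.
  rewrite uniq_pairwise; apply: sub_pairwise dif => a b /= H.
  by apply/eqP => E; move: H; rewrite E addn3 ltnNge leqW // leqW.
have szp : (size p <= N)%N.
  rewrite -(size_iota 1 N); apply: uniq_leq_size => // a ap.
  by rewrite mem_iota (allP pos _ ap) add1n ltnS leN.
have smp : (sumn p <= size p * N)%N.
  elim: (p) leN => [|a t IH] //= H; rewrite mulSn leq_add ?H ?mem_head //.
  by apply: IH => b bt; apply: H; rewrite inE bt orbT.
case/orP: out; rewrite ltnNge; apply/negP; rewrite negbK.
  rewrite -wm mul2n -addnn leq_add //.
  exact: leq_trans (count_size _ _) szp.
by rewrite -sn (leq_trans smp) // leq_mul2r szp orbT.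
Qed.

Lemma coef_alladi_schur (N m n : nat) :
  (alladi_schur N%:Z)`_m`_n = (schurD N m n)%:Z.
Proof.
rewrite /= coef_poly ltnS; case: leqP => hm; last first.
  by rewrite coef0 schurD_eq0 ?hm.
rewrite coef_poly ltnS; case: leqP => hn //.
by rewrite schurD_eq0 ?hn ?orbT.
Qed.

Lemma schur_p_neq0 (n : nat) : schur_p n != 0.
Proof.
apply/eqP => /(congr1 (fun p : {poly {poly int}} => p.[0])).
rewrite horner_prod horner0 big1 ?(rwP eqP) ?oner_eq0 // => i _.
by rewrite !hornerE /= ?expr0n /= ?mulr0 ?addr0.
Qed.

Lemma schur_quotientE (n : nat) (r : {poly {poly int}}) :
  alladi_schur (6 * n%:Z - 1) = schur_p n * r -> schur_quotient n = r.
Proof.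
move=> dr; apply: xget_unique => // r' /=.
by rewrite dr => /(mulfI (schur_p_neq0 n)).
Qed.

(* In {poly int}, %/ is a pseudo-division in general; by 1 - q^2, whose       *)
(* leading coefficient -1 is a unit, it is the true quotient.                 *)
Lemma geom_divK (e k : nat) :
  (('X^e * (1 - 'X^(4 * k))) %/ (1 - 'X^2)) * (1 - 'X^2) =
  'X^e * (1 - 'X^(4 * k)) :> {poly int}.
Proof.
have lc : lead_coef (1 - 'X^2 : {poly int}) \is a GRing.unit.
  have -> : 1 - 'X^2 = - ('X^2 - 1%:P) :> {poly int} by rewrite opprB.
  by rewrite lead_coefN lead_coefXnsubC.
have -> : (4 * k = 2 * (2 * k))%N by rewrite mulnA.
have -> : 1 - 'X^(2 * (2 * k)) =
    (1 - 'X^2) * \sum_(i < 2 * k) ('X^2) ^+ i :> {poly int}.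
  by rewrite exprM -[LHS]opprB subrX1 -mulNr opprB.
by rewrite mulrCA mulrC Pdiv.IdomainUnit.mulKp // mulrC.
Qed.

(* Main.v *)
Require Import Defs.
From mathcomp Require Import all_boot all_order all_algebra.
From mathcomp Require Import zify ring.
Import Order.TTheory GRing.Theory Num.Theory.
Local Open Scope ring_scope.

(** Write [w_k] for the monomial [x q^k] ([k] odd) or [x^2 q^k] ([k] even) of a
    part [k], so that [d_N] is the sum of the products of the [w_k] over the
    Schur partitions with parts at most [N].  Removing the largest part gives
    [d_N = d_(N-1) + w_N d_(N-3)], with [d_(N-4)] instead of [d_(N-3)] when [3]
    divides [N] ([schur_gfS]).

    The heart of the proof is a reflection of this recurrence in a
    [q]-difference equation: for [m = 1, 2 (mod 3)],
      [d_(2m)(x) = (1 + x q + x^2 q^2) d_(2m-3)(x q^2)]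
    ([schur_gf_even]).  The two residues are proved together by induction: the
    recurrence for [d_(2m-3)] turns into the one for [d_(2m)] because
    [x -> x q^2] sends [w_k] to [w_(k+2)] or [w_(k+4)].  Since also
    [p_(n+1)(x) = (1 + x q + x^2 q^2) p_n(x q^2)], the factor [p_n] propagates
    from [d_(6n-1)] and [d_(6n+1)] to [d_(6n+2)] and [d_(6n+4)], and from there
    to [d_(6n+5)] and [d_(6n+7)] ([schur_gf_factor]).  The quotients
    [F_n = d_(6n-1) / p_n] and [H_n = d_(6n+1) / p_n] hence satisfy
      [F_(n+1)(x) = H_n(x q^2) + w_(6n+5) F_n(x q^2)],
      [H_(n+1)(x) = F_(n+1)(x) + w_(6n+6) F_n(x q^2) + w_(6n+7) H_n(x q^2)],
    with [F_0 = 1] and [H_0 = 1 + x q].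

    No subtraction occurs in this system, so all coefficients are nonnegative,
    and the three assertions can be read off.  The first one says that
    [H_(n-1)(x q^2)] is nonnegative.  The second one follows from the first by
    induction on [j], starting from the closed form of [c(n,1)].  The third one
    holds for [F_n] and [H_n] together by induction on [n]. *)

(** * Listing the Schur partitions *)

(** The least distance that a largest part [a] forces between itself and every other
    part: a part [a - 3] is excluded when [a], and hence [a - 3], is a multiple
    of [3]. *)
Definition gap (a : nat) : nat := 3 + (3 %| a)%N.

Definition is_schur (s : seq nat) : bool :=
  [&& sorted geq s, all (leq 1) s & schur_cond s].

Lemma is_schur_cons (a : nat) (s : seq nat) :
  is_schur (a :: s) =
  [&& (0 < a)%N, is_schur s & all (fun b => b + gap a <= a)%N s].
Proof.
rewrite /is_schur /schur_cond /= (path_sortedE (rev_trans leq_trans)).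
apply/idP/idP.
  case/and4P=> /andP[_ ->] /andP[-> ->] /andP[hd ->] /= /andP[_ hm].
  apply/andP; split.
    apply/allP => b bs; apply/implyP => b3.
    by have /= := allP hm b bs; rewrite b3 inE negb_or => /andP[].
  apply/allP => b bs; have := allP hd b bs; have := allP hm b bs.
  rewrite /gap inE negb_or /=; case: (boolP (3 %| a)%N) => a3 /=; last lia.
  by case: (boolP (3 %| b)%N) => /= b3 h1 h2; first case/andP: h1; lia.
case/and3P=> a0 /and3P[-> -> /andP[-> hm]] hg.
rewrite a0 /= !andbT; apply/and4P; split.
- by apply/allP => b /(allP hg) /=; rewrite /gap; lia.
- by apply/allP => b /(allP hg) /=; rewrite /gap; lia.
- apply/implyP => _; rewrite inE negb_or; apply/andP; split; first lia.
  by apply/negP => /(allP hg) /=; lia.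
- apply/allP => b bs; apply/implyP => b3; rewrite inE negb_or.
  have := allP hm b bs; rewrite b3 /= => ->; rewrite andbT.
  have := allP hg b bs; rewrite /gap; apply: contraTneq => e.
  by rewrite -e dvdn_addl // b3; lia.
Qed.

(** The truncated subtraction is harmless: for the parts [1], [2] and [3] it
    leaves the list of the partitions without parts, as it should. *)
Fixpoint schur_seqs (N : nat) : seq (seq nat) :=
  if N is M.+1 then
    schur_seqs M ++ [seq N :: s | s <- schur_seqs (M - (2 + (3 %| N)))]
  else [:: [::]].

Lemma is_schur_head (M a : nat) (s : seq nat) :
  is_schur (a :: s) -> all (geq M) (a :: s) = (a <= M)%N.
Proof.
rewrite is_schur_cons => /and3P[_ _ /allP hg] /=.
case: leqP => // aM; apply/allP => b /hg /=; lia.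
Qed.

Lemma mem_schur_seqs (N : nat) (s : seq nat) :
  (s \in schur_seqs N) = is_schur s && all (geq N) s.
Proof.
elim/ltn_ind: N s => -[_|N IH] [|a s] //.
- by rewrite inE andbC /= is_schur_cons; case: a => [|a]; rewrite /= ?andbF.
- by rewrite mem_cat IH.
rewrite [schur_seqs _]/= mem_cat IH //.
set M := (N - _)%N.
have -> : (a :: s \in [seq N.+1 :: s0 | s0 <- schur_seqs M])
   = (a == N.+1) && (s \in schur_seqs M).
  apply/mapP/andP => [[t tL [-> ->]]|[/eqP -> sL]]; first by rewrite eqxx.
  by exists s.
rewrite IH ?ltnS ?leq_subr //.
have [->|aN] := eqVneq a N.+1.
  rewrite /= ltnn andbF /= leqnn is_schur_cons ltn0Sn /=.
  case: (boolP (is_schur s)) => //= /and3P[_ /allP pos _].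
  apply/idP/andP => [hM|[hg _]].
    by split; apply/allP => b bs; have := pos b bs; have := allP hM b bs;
       rewrite /M /gap /=; lia.
  by apply/allP => b bs; have := pos b bs; have := allP hg b bs;
     rewrite /M /gap /=; lia.
rewrite orbF; case: (boolP (is_schur (a :: s))) => //= sch.
rewrite -!/(all (geq _) (a :: s)) !is_schur_head //; lia.
Qed.

Lemma uniq_schur_seqs (N : nat) : uniq (schur_seqs N).
Proof.
elim/ltn_ind: N => -[|N] IH //=.
rewrite cat_uniq IH // map_inj_uniq ?IH ?ltnS ?leq_subr //; last first.
  by move=> s t [].
rewrite andbT; apply/hasPn => s /mapP[t _ ->].
by rewrite mem_schur_seqs /= ltnn andbF.
Qed.

(** Sequences over [{0, ..., N}] of length at most [n] lose no partition of [n],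
    as its parts are positive. *)
Lemma schurD_count (N m n : nat) :
  schurD N m n =
  count (fun s => (sumn s == n) && (schur_weight s == m)) (schur_seqs N).
Proof.
rewrite /schurD -size_filter cardE.
pose g (s : n.-bseq 'I_N.+1) := [seq val i | i <- s].
have g_inj : injective g.
  by move=> s t /(inj_map val_inj) /val_inj.
rewrite -(size_map g); apply: perm_size; apply: uniq_perm.
- by rewrite map_inj_uniq ?enum_uniq.
- by rewrite filter_uniq ?uniq_schur_seqs.
move=> s; rewrite mem_filter mem_schur_seqs; apply/mapP/idP.
  case=> t; rewrite mem_enum inE => /and3P[/and3P[srt pos st] sch wt] ->.
  rewrite /g st wt /is_schur srt pos sch /=.
  by apply/allP => _ /mapP[i _ ->] /=; rewrite -ltnS.
case/andP=> /andP[/eqP sn wm] /andP[/and3P[srt pos sch] leN].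
have sz : (size [seq (inord i : 'I_N.+1) | i <- s] <= n)%N.
  rewrite size_map -sn; elim: (s) pos => //= a t IH /andP[a0 /IH]; lia.
have sE : s = g (Bseq sz).
  rewrite /g /= -map_comp -[LHS]map_id; apply/eq_in_map => a /(allP leN) /= aN.
  by rewrite inordK.
exists (Bseq sz) => //.
by rewrite mem_enum inE -/(g _) -sE /is_partition srt pos sn eqxx sch wm.
Qed.

(** * Generating functions and their largest-part recurrence *)

Definition qvar : {poly {poly int}} := 'X%:P.

Definition part_monomial (a : nat) : {poly {poly int}} :=
  qvar ^+ a * 'X ^+ (1 + ~~ odd a).

Definition schur_gf (N : nat) : {poly {poly int}} :=
  \sum_(s <- schur_seqs N) \prod_(a <- s) part_monomial a.

Lemma schur_gf0 : schur_gf 0 = 1.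
Proof. by rewrite /schur_gf big_seq1 big_nil. Qed.

Lemma schur_gfS (N : nat) :
  schur_gf N.+1 =
  schur_gf N + part_monomial N.+1 * schur_gf (N - (2 + (3 %| N.+1)%N)).
Proof.
rewrite /schur_gf big_cat big_map mulr_sumr; congr (_ + _).
by apply: eq_bigr => s _; rewrite big_cons.
Qed.

Lemma prod_part_monomial (s : seq nat) :
  \prod_(a <- s) part_monomial a = qvar ^+ sumn s * 'X ^+ schur_weight s.
Proof.
elim: s => [|a s IH]; first by rewrite big_nil mulr1.
rewrite big_cons IH /part_monomial.
have -> : schur_weight (a :: s) = (1 + ~~ odd a + schur_weight s)%N.
  by rewrite /schur_weight /=; lia.
by rewrite /= !exprD; ring.
Qed.

Lemma coef_qvar_exp (n m i j : nat) :
  (qvar ^+ n * 'X ^+ m : {poly {poly int}})`_i`_j = ((n == j) && (m == i))%:R.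
Proof.
rewrite /qvar -rmorphXn coefCM coefXn eq_sym; case: (m == i).
  by rewrite mulr1 coefXn andbT eq_sym.
by rewrite mulr0 coef0 andbF.
Qed.

Lemma alladi_schurE (N : nat) : alladi_schur N%:Z = schur_gf N.
Proof.
apply/polyP => m; apply/polyP => n.
rewrite coef_alladi_schur schurD_count /schur_gf !coef_sum -sum1_count.
rewrite -[LHS]intz sumMz big_mkcond.
apply: eq_bigr => s _; rewrite prod_part_monomial coef_qvar_exp.
by case: (_ && _).
Qed.

(** * The q-difference equation *)

(** The substitution [x -> x q^2]. *)
Notation dilate := (comp_poly (qvar ^+ 2 * 'X)).

Lemma dilate_qvar_exp (n : nat) : dilate (qvar ^+ n) = qvar ^+ n.
Proof. by rewrite rmorphXn /= comp_polyC. Qed.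

Lemma coef_dilate (u : {poly {poly int}}) (i : nat) :
  (dilate u)`_i = 'X^(2 * i) * u`_i.
Proof.
elim/poly_ind: u i => [|u c IH] i; first by rewrite comp_poly0 !coef0 mulr0.
rewrite comp_poly_MXaddC mulrA !coefD !coefC !coefMX.
case: i => [|i] /=; first by rewrite !add0r muln0 mul1r.
have q2 : qvar ^+ 2 = ('X^2)%:P by rewrite rmorphXn.
by rewrite !addr0 {2}q2 coefMC IH mulrC mulrA -exprD mulnS.
Qed.

Lemma part_monomialD (n k : nat) :
  part_monomial (6 * n + k) = qvar ^+ (6 * n) * part_monomial k.
Proof. by rewrite /part_monomial exprD oddD oddM mulrA. Qed.

(** The recurrence along one period, kept only at the indices [-1], [1], [2] and
    [4] modulo [6].  For [n = 0] the index [6 n - 1] is truncated to [0], which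
    agrees with the convention [d_(-1) = 1] since [d_0 = 1]. *)
Lemma schur_gf_mod6 (n : nat) :
  [/\ schur_gf (6 * n + 2) =
        schur_gf (6 * n + 1) + part_monomial (6 * n + 2) * schur_gf (6 * n - 1),
      schur_gf (6 * n + 4) =
        schur_gf (6 * n + 2) + part_monomial (6 * n + 3) * schur_gf (6 * n - 1)
        + part_monomial (6 * n + 4) * schur_gf (6 * n + 1),
      schur_gf (6 * n + 5) =
        schur_gf (6 * n + 4) + part_monomial (6 * n + 5) * schur_gf (6 * n + 2)
    & schur_gf (6 * n + 7) =
        schur_gf (6 * n + 5) + part_monomial (6 * n + 6) * schur_gf (6 * n + 2)
        + part_monomial (6 * n + 7) * schur_gf (6 * n + 4)].
Proof.
have rec k e : (k.+1 - (3 + (3 %| k.+1)) = e)%N ->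
    schur_gf k.+1 = schur_gf k + part_monomial k.+1 * schur_gf e.
  by move=> <-; rewrite schur_gfS subSS.
split.
- by rewrite addnS (rec _ (6 * n - 1)%N) //; lia.
- rewrite addnS (rec _ (6 * n + 1)%N); last by lia.
  by rewrite [in LHS]addnS (rec _ (6 * n - 1)%N) // -?addnS //; lia.
- by rewrite addnS (rec _ (6 * n + 2)%N) //; lia.
- rewrite addnS (rec _ (6 * n + 4)%N); last by lia.
  by rewrite [in LHS]addnS (rec _ (6 * n + 2)%N) // -?addnS //; lia.
Qed.

Lemma dilate_part_monomial (n k : nat) (u : {poly {poly int}}) :
  dilate (part_monomial (6 * n + k) * u) =
  qvar ^+ (6 * n) * qvar ^+ (k + 2 * (1 + ~~ odd k)) * 'X ^+ (1 + ~~ odd k)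
  * dilate u.
Proof.
rewrite comp_polyM; congr (_ * _).
rewrite part_monomialD /part_monomial !rmorphM /= !dilate_qvar_exp rmorphXn /=.
rewrite comp_polyX.
by rewrite exprMn -exprM (exprD _ k) !mulrA.
Qed.

(** Expanding [d_(6n+5)] and [d_(6n+7)] down to [d_(6n-1)] and [d_(6n+1)] before
    dilating lets the induction hypothesis evaluate [P(x) d(x q^2)], with
    [P(x) = 1 + x q + x^2 q^2], for every term; both sides become combinations of [d_(6n+2)] and [d_(6n+4)], equal
    because [w_a w_b] depends only on [a + b] and on the parities of [a] and
    [b]. *)
Lemma schur_gf_even (n : nat) :
  schur_gf (6 * n + 2) =
    (1 + qvar * 'X + qvar ^+ 2 * 'X ^+ 2) * dilate (schur_gf (6 * n - 1)) /\
  schur_gf (6 * n + 4) =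
    (1 + qvar * 'X + qvar ^+ 2 * 'X ^+ 2) * dilate (schur_gf (6 * n + 1)).
Proof.
set P := 1 + _ + _; elim: n => [|n [IHf IHh]].
  have [-> -> _ _] := schur_gf_mod6 0; rewrite !schur_gfS /= schur_gf0.
  rewrite /P /part_monomial /= !rmorphD !rmorphM !rmorphXn /= !rmorph1.
  by rewrite !comp_polyC comp_polyX; split; ring.
have [Ea Eb Ef Eh] := schur_gf_mod6 n.
have [-> -> _ _] := schur_gf_mod6 n.+1.
have -> : (6 * n.+1 - 1 = 6 * n + 5)%N by lia.
have -> : (6 * n.+1 + 1 = 6 * n + 7)%N by lia.
(* [Da] and [Db] dilate the even-indexed polynomials, [Df] and [Dh] the
   odd-indexed ones, each from the previous ones. *)
have Da : P * dilate (schur_gf (6 * n + 2)) =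
    schur_gf (6 * n + 4) + part_monomial (6 * n + 6) * schur_gf (6 * n + 2).
  rewrite {1}Ea comp_polyD dilate_part_monomial mulrDr -IHh mulrCA -IHf.
  by rewrite part_monomialD /part_monomial !mulrA.
have Db : P * dilate (schur_gf (6 * n + 4)) =
    P * dilate (schur_gf (6 * n + 2))
    + part_monomial (6 * n + 5) * schur_gf (6 * n + 2)
    + part_monomial (6 * n + 8) * schur_gf (6 * n + 4).
  rewrite {1}Eb !comp_polyD !dilate_part_monomial !mulrDr.
  rewrite ![P * (_ * _)]mulrCA -IHh -IHf.
  by rewrite !part_monomialD /part_monomial !mulrA.
have Df : P * dilate (schur_gf (6 * n + 5)) =
    P * dilate (schur_gf (6 * n + 4))
    + part_monomial (6 * n + 7) * (P * dilate (schur_gf (6 * n + 2))).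
  rewrite Ef comp_polyD dilate_part_monomial mulrDr [P * (_ * _)]mulrCA.
  by rewrite part_monomialD /part_monomial !mulrA.
have Dh : P * dilate (schur_gf (6 * n + 7)) =
    P * dilate (schur_gf (6 * n + 5))
    + part_monomial (6 * n + 10) * (P * dilate (schur_gf (6 * n + 2)))
    + part_monomial (6 * n + 9) * (P * dilate (schur_gf (6 * n + 4))).
  rewrite Eh !comp_polyD !dilate_part_monomial !mulrDr ![P * (_ * _)]mulrCA.
  by rewrite !part_monomialD /part_monomial !mulrA.
rewrite Dh Df Db Da Eh Ef.
have E6 m : part_monomial (6 * n.+1 + m) = part_monomial (6 * n + (6 + m)).
  by rewrite mulnS [(6 + 6 * n)%N]addnC addnA.
rewrite !E6 !part_monomialD /part_monomial /=; split; ring.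
Qed.

(** * The quotients and their positive recurrence *)

(** The quotients of [d_(6n-1)] and [d_(6n+1)] by [p_n], introduced as the
    solution of their recurrence so that divisibility by [p_n] comes for free. *)
Fixpoint schur_FH (n : nat) : {poly {poly int}} * {poly {poly int}} :=
  if n is m.+1 then
    let: (F, H) := schur_FH m in
    let F' := dilate H + part_monomial (6 * m + 5) * dilate F in
    (F', F' + part_monomial (6 * m + 6) * dilate F
            + part_monomial (6 * m + 7) * dilate H)
  else (1, 1 + part_monomial 1).

Definition schur_F (n : nat) : {poly {poly int}} := (schur_FH n).1.
Definition schur_H (n : nat) : {poly {poly int}} := (schur_FH n).2.

Lemma schur_FS (n : nat) :
  schur_F n.+1 =
  dilate (schur_H n) + part_monomial (6 * n + 5) * dilate (schur_F n).
Proof. by rewrite /schur_F /schur_H /=; case: (schur_FH n). Qed.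

Lemma schur_HS (n : nat) :
  schur_H n.+1 =
  schur_F n.+1 + part_monomial (6 * n + 6) * dilate (schur_F n)
  + part_monomial (6 * n + 7) * dilate (schur_H n).
Proof. by rewrite /schur_F /schur_H /=; case: (schur_FH n). Qed.

Lemma schur_pS (n : nat) :
  schur_p n.+1 = (1 + qvar * 'X + qvar ^+ 2 * 'X ^+ 2) * dilate (schur_p n).
Proof.
rewrite /schur_p big_nat_recl // rmorph_prod; congr (_ * _).
  by rewrite -!mul_polyC !rmorphXn.
apply: eq_big_nat => i /andP[i0 _].
rewrite -!mul_polyC !rmorphXn -/qvar /= !comp_polyD !comp_polyM !dilate_qvar_exp.
have -> : (2 * i.+1 - 1 = 2 * i - 1 + 2)%N by lia.
have -> : (4 * i.+1 - 2 = 4 * i - 2 + 4)%N by lia.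
by rewrite rmorph1 comp_polyX !exprD -/qvar; ring.
Qed.

(** The dilation sends [p_n] to [p_(n+1) / (1 + x q + x^2 q^2)], exactly the
    factor supplied by [schur_gf_even]. *)
Lemma schur_gf_factor (n : nat) :
  schur_gf (6 * n - 1) = schur_p n * schur_F n /\
  schur_gf (6 * n + 1) = schur_p n * schur_H n.
Proof.
elim: n => [|n [IHf IHh]].
  rewrite /schur_p big_geq // !mul1r /schur_F /schur_H /=.
  by rewrite schur_gfS schur_gf0 mulr1.
have -> : (6 * n.+1 - 1 = 6 * n + 5)%N by lia.
have -> : (6 * n.+1 + 1 = 6 * n + 7)%N by lia.
have [_ _ -> ->] := schur_gf_mod6 n; have [_ _ -> _] := schur_gf_mod6 n.
have [-> ->] := schur_gf_even n.
have pS u : (1 + qvar * 'X + qvar ^+ 2 * 'X ^+ 2) * dilate (schur_p n * u) =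
    schur_p n.+1 * dilate u by rewrite comp_polyM mulrA -schur_pS.
rewrite IHf IHh !pS schur_HS schur_FS.
by split; ring.
Qed.

Lemma schur_cE (n j : nat) : schur_c n j = (schur_F n)`_j.
Proof.
rewrite /schur_c (@schur_quotientE n (schur_F n)) //.
have [<- _] := schur_gf_factor n; case: n => [|n]; first by rewrite schur_gf0.
by rewrite -alladi_schurE; congr alladi_schur; lia.
Qed.

Lemma coef_part_monomialM (n k : nat) (u : {poly {poly int}}) (j : nat) :
  (part_monomial (6 * n + k) * dilate u)`_j =
  if (j < 1 + ~~ odd k)%N then 0 else
  'X^(6 * n + k + 2 * (j - (1 + ~~ odd k))) * u`_(j - (1 + ~~ odd k)).
Proof.
have -> : part_monomial (6 * n + k) = ('X^(6 * n + k))%:P * 'X^(1 + ~~ odd k).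
  by rewrite rmorphXn /part_monomial oddD oddM.
rewrite -mulrA coefCM coefXnM; case: ifP => _; first by rewrite mulr0.
by rewrite coef_dilate mulrA -exprD.
Qed.

Lemma coef_schur_FS (n j : nat) :
  (schur_F n.+1)`_j = 'X^(2 * j) * (schur_H n)`_j +
    if j is i.+1 then 'X^(6 * n + 5 + 2 * i) * (schur_F n)`_i else 0.
Proof.
rewrite schur_FS coefD coef_dilate coef_part_monomialM /= addn0.
by case: j => [|j] //; rewrite subn1.
Qed.

Lemma coef_schur_HS (n j : nat) :
  (schur_H n.+1)`_j = (schur_F n.+1)`_j
    + (if j is i.+2 then 'X^(6 * n + 6 + 2 * i) * (schur_F n)`_i else 0)
    + (if j is i.+1 then 'X^(6 * n + 7 + 2 * i) * (schur_H n)`_i else 0).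
Proof.
rewrite schur_HS 2!coefD !coef_part_monomialM /=.
by case: j => [|[|j]]; rewrite ?subn1 ?subn2.
Qed.

Lemma coef_schur_F0 (j : nat) : (schur_F 0)`_j = (j == 0%N)%:R.
Proof. by rewrite coef1. Qed.

Lemma coef_schur_H0 (j : nat) :
  (schur_H 0)`_j = (j == 0%N)%:R + 'X * (j == 1%N)%:R.
Proof. by rewrite coefD coef1 coefCM coefX. Qed.

(** * Positivity, divisibility and the lower bounds *)

Lemma coef_ge0D (u v : {poly int}) :
  coef_le 0 u -> coef_le 0 v -> coef_le 0 (u + v).
Proof.
by move=> hu hv i; move: (hu i) (hv i); rewrite !coef0 coefD; exact: addr_ge0.
Qed.

Lemma coef_leXnM (k : nat) (u v : {poly int}) :
  coef_le u v -> coef_le ('X^k * u) ('X^k * v).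
Proof. by move=> uv i; rewrite !coefXnM; case: ifP. Qed.

Lemma coef_ge0XnM (k : nat) (u : {poly int}) :
  coef_le 0 u -> coef_le 0 ('X^k * u).
Proof. by move/(coef_leXnM k); rewrite mulr0. Qed.

Lemma schur_FH_ge0 (n : nat) :
  (forall j, coef_le 0 (schur_F n)`_j) /\ (forall j, coef_le 0 (schur_H n)`_j).
Proof.
have ge0_b (b : bool) : coef_le 0 b%:R.
  by case: b => i; rewrite coef0 ?coef1 ?coef0 //; case: i.
elim: n => [|n [IHf IHh]].
  split=> j; rewrite ?coef_schur_F0 ?coef_schur_H0; first exact: ge0_b.
  by apply: coef_ge0D; last apply: (coef_ge0XnM 1); exact: ge0_b.
have IHF j : coef_le 0 (schur_F n.+1)`_j.
  rewrite coef_schur_FS; apply: coef_ge0D; first exact: coef_ge0XnM.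
  by case: j => // j; exact: coef_ge0XnM.
split=> // j; rewrite coef_schur_HS.
apply: coef_ge0D; first apply: coef_ge0D; first exact: IHF.
  by case: j => [|[|j]] //; exact: coef_ge0XnM.
by case: j => // j; exact: coef_ge0XnM.
Qed.

Definition Xn_divides (k : nat) (u : {poly int}) : Prop :=
  exists r : {poly int}, u = 'X^k * r.

Lemma Xn_divides0 (k : nat) : Xn_divides k 0.
Proof. by exists 0; rewrite mulr0. Qed.

Lemma Xn_dividesD (k : nat) (u v : {poly int}) :
  Xn_divides k u -> Xn_divides k v -> Xn_divides k (u + v).
Proof. by move=> [r ->] [s ->]; exists (r + s); rewrite mulrDr. Qed.

Lemma Xn_dividesM (k l m : nat) (u : {poly int}) :
  Xn_divides l u -> (k <= m + l)%N -> Xn_divides k ('X^m * u).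
Proof.
move=> [r ->] klm; exists ('X^(m + l - k) * r).
by rewrite !mulrA -!exprD subnKC.
Qed.

(** Each step of the recurrence multiplies the coefficient of [x^j] by at least
    [q^(2j)], which is the growth of [(2 n + 1) j] in [n]; the terms that come
    from a lower power of [x] carry much more. *)
Lemma schur_FH_divides (n : nat) :
  (forall j, Xn_divides ((2 * n + 1) * j) (schur_F n)`_j) /\
  (forall j, Xn_divides ((2 * n + 1) * j) (schur_H n)`_j).
Proof.
elim: n => [|n [IHf IHh]].
  split=> -[|[|j]]; rewrite ?coef_schur_F0 ?coef_schur_H0 /= ?mulr0 ?addr0.
  - by exists 1; rewrite mulr1.
  - exact: Xn_divides0.
  - exact: Xn_divides0.
  - by exists 1; rewrite mulr1.
  - by exists 1; rewrite add0r.
  - exact: Xn_divides0.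
have IHF j : Xn_divides ((2 * n.+1 + 1) * j) (schur_F n.+1)`_j.
  rewrite coef_schur_FS; apply: Xn_dividesD.
    by apply: Xn_dividesM (IHh j) _; lia.
  case: j => [|j]; first exact: Xn_divides0.
  by apply: Xn_dividesM (IHf j) _; lia.
split=> // j; rewrite coef_schur_HS.
apply: Xn_dividesD; first apply: Xn_dividesD; first exact: IHF.
  case: j => [|[|j]]; try exact: Xn_divides0.
  by apply: Xn_dividesM (IHf j) _; lia.
case: j => [|j]; first exact: Xn_divides0.
by apply: Xn_dividesM (IHh j) _; lia.
Qed.

(** The difference of the two sides is a coefficient of [H_n(x q^2)]. *)
Lemma schur_F_ge_shift (n j : nat) :
  coef_le ('X^(6 * n + 5 + 2 * j) * (schur_F n)`_j) (schur_F n.+1)`_j.+1.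
Proof.
rewrite coef_schur_FS => i; rewrite coefD lerDr.
have [_ /(_ j.+1) H0] := schur_FH_ge0 n.
by have := coef_ge0XnM (2 * j.+1) _ H0 i; rewrite coef0.
Qed.

(** In other words, the coefficient of [x] is the sum of the [q^(2n+1+2i)] for
    [i < 2 n].  The coefficient of [x] in [H_n] has to be followed along. *)
Lemma schur_F_coef1 (n : nat) :
  (schur_F n)`_1 * (1 - 'X^2) = 'X^(2 * n + 1) * (1 - 'X^(4 * n)).
Proof.
suff [_ _ ->] : [/\ (schur_F n)`_0 = 1 /\ (schur_H n)`_0 = 1,
   (schur_H n)`_1 = (schur_F n)`_1 + 'X^(6 * n + 1) &
   (schur_F n)`_1 * (1 - 'X^2) = 'X^(2 * n + 1) * (1 - 'X^(4 * n))] by [].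
elim: n => [|n [[F0 H0] H1 F1]].
  rewrite !coef_schur_F0 !coef_schur_H0 /= mulr0 mulr1 addr0 expr0.
  by rewrite subrr mulr0 mul0r.
have F1S : (schur_F n.+1)`_1 =
    'X^2 * ((schur_F n)`_1 + 'X^(6 * n + 1)) + 'X^(6 * n + 5).
  by rewrite coef_schur_FS H1 F0 addn0 mulr1.
have F0S : (schur_F n.+1)`_0 = 1 by rewrite coef_schur_FS H0 addr0 mul1r.
split; first split=> //.
- by rewrite coef_schur_HS F0S !addr0.
- by rewrite coef_schur_HS addr0 H0 mulr1; congr (_ + 'X^_); lia.
have -> : (schur_F n.+1)`_1 * (1 - 'X^2) =
  'X^2 * ((schur_F n)`_1 * (1 - 'X^2))
  + ('X^(6 * n + 3) + 'X^(6 * n + 5)) * (1 - 'X^2).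
  by rewrite F1S !exprD; ring.
have -> : (6 * n = 2 * n + 4 * n)%N by lia.
have -> : (2 * n.+1 + 1 = 2 * n + 3)%N by lia.
have -> : (4 * n.+1 = 4 * n + 4)%N by lia.
by rewrite F1 !exprD; ring.
Qed.

Definition geometric (e k : nat) : {poly int} :=
  ('X^e * (1 - 'X^(4 * k))) %/ (1 - 'X^2).

Lemma geometricE (e k : nat) (u : {poly int}) :
  u * (1 - 'X^2) = 'X^e * (1 - 'X^(4 * k)) -> u = geometric e k.
Proof.
move=> hu; apply: (@mulIf _ (1 - 'X^2)); last by rewrite hu geom_divK.
apply/eqP => /(congr1 (fun p : {poly int} => p`_0)).
by rewrite coefB coef1 coefXn coef0.
Qed.

(** Passing from [(n, j)] to [(n + 1, j + 1)] preserves [n - j], so the geometric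
    sum is only multiplied by a power of [q], the one in [schur_F_ge_shift].  The
    induction starts at [j = 1], where equality holds. *)
Lemma schur_F_ge_geometric (n j : nat) : (0 < j <= n)%N ->
  coef_le (geometric (6 * j * n + 5 * j - 2 * j ^ 2 - 4 * n - 2) (n - j + 1))
          (schur_F n)`_j.
Proof.
elim: j n => // j IH [|n] //= jn.
case: j IH jn => [|j] IH jn.
  rewrite (geometricE _ _ _ (schur_F_coef1 n.+1)) => i.
  have -> : (6 * 1 * n.+1 + 5 * 1 - 2 * 1 ^ 2 - 4 * n.+1 - 2 = 2 * n.+1 + 1)%N.
    by lia.
  by have -> : (n.+1 - 1 + 1 = n.+1)%N by lia.
have -> : geometric (6 * j.+2 * n.+1 + 5 * j.+2 - 2 * j.+2 ^ 2 - 4 * n.+1 - 2)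
            (n.+1 - j.+2 + 1) =
          'X^(6 * n + 5 + 2 * j.+1) *
          geometric (6 * j.+1 * n + 5 * j.+1 - 2 * j.+1 ^ 2 - 4 * n - 2)
            (n - j.+1 + 1).
  apply/esym/geometricE; rewrite -mulrA geom_divK mulrA -exprD subSS.
  congr ('X^_ * _); have [d ->] : exists d, n = (j.+1 + d)%N.
    by exists (n - j.+1)%N; lia.
  by rewrite -!mulnn; nia.
move=> i; apply: le_trans (schur_F_ge_shift n j.+1 i).
by apply: coef_leXnM; apply: IH; lia.
Qed.

(* No natural-number subtraction below is truncated when 0 < j <= n, and %/ is
   exact by geom_divK. *)
Theorem mainTheorem4 (n j : nat) (hj : (0 < j)%N) (hjn : (j <= n)%N) :
  [/\ coef_le ('X^(6 * n - 1) * schur_c (n - 1) (j - 1) * 'X^(2 * (j - 1)))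
              (schur_c n j),
      coef_le (('X^(6 * j * n + 5 * j - 2 * j ^ 2 - 4 * n - 2)
                  * (1 - 'X^(4 * (n - j + 1)))) %/ (1 - 'X^2))
              (schur_c n j)
    & exists r : {poly int}, schur_c n j = 'X^((2 * n + 1) * j) * r].
Proof.
rewrite !schur_cE; split; last 2 first.
- by apply: schur_F_ge_geometric; rewrite hj.
- by have [/(_ j)] := schur_FH_divides n.
case: j n hj hjn => // j [|n] // _ _.
rewrite !subn1 /= mulrAC -exprD.
have -> : ((6 * n.+1).-1 + 2 * j = 6 * n + 5 + 2 * j)%N by lia.
exact: schur_F_ge_shift.
Qed.
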